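(* Let $a<b$, let $y$ be an extremal of $J[y]=\int_a^b F(x,y,y')\,dx$ satisfying the mixed boundary conditions $y'(a)=0$ (free) and $y(b)=B$ (fixed), and let $P,Q,R$ be the functions on $[a,b]$ given by $$P=\frac{\partial^2F}{\partial y'^2},\qquad R=\frac{\partial^2F}{\partial y\,\partial y'},\qquad Q=\frac{\partial^2F}{\partial y^2}-\frac{dR}{dx},$$ with the partial derivatives evaluated at $(x,y(x),y'(x))$. Suppose that $P(x)>0$ for all $x\in[a,b]$ and that $R(a)=0$. Let $u=u(x)$ be a nontrivial solution on $[a,b]$ of $$\mathbf L(u):=-\frac{d}{dx}\left(Pu'\right)+Qu=0$$ satisfying $u'(a)=0$. Then the second variation $\delta^2J[h]=\left.Rh^2\right|_a^b+\int_a^b\left(Ph'^2+Qh^2\right)dx$ satisfies $\delta^2J[h]>0$ for every piecewise smooth $h:[a,b]\to\mathbb R$ with $h\not\equiv0$, $h'(a)=0$ and $h(b)=0$ if and only if $u(x)\neq0$ for all $a<x\le b$.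
   Context: The function $F=F(x,y,y')$ is real valued; $F$, $y$, and the functions derived from them are assumed to have continuous derivatives of as many orders as needed. An extremal is a solution of the Euler--Lagrange equation $\frac{\partial F}{\partial y}-\frac{d}{dx}\frac{\partial F}{\partial y'}=0$ on $[a,b]$. The symbol $'$ denotes $d/dx$. ''Piecewise smooth'' means continuous and piecewise continuously differentiable on $[a,b]$; $h'(a)$ denotes the (one-sided) derivative at $a$. The notation $\left.f\right|_a^b$ means $f(b)-f(a)$. *)

(* Defs.v *)
(* Stdlib real numbers with Coquelicot. *)
From Stdlib Require Import Reals Lra Lia.
From Coquelicot Require Import Coquelicot.
Open Scope R_scope.

Definition segment (a b x : R) : Prop := a <= x <= b.

(** Functions on [a, b] are total functions [R -> R] of which only the values on
    [a, b] matter: the difference quotient is taken along points of [a, b], so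
    the derivative is one-sided at [a] and at [b]. *)

Definition is_derive_on (a b : R) (f : R -> R) (x l : R) : Prop :=
  D_in f (fun _ => l) (segment a b) x.

Definition ex_derive_on (a b : R) (f : R -> R) (x : R) : Prop :=
  exists l, is_derive_on a b f x l.

(** Arbitrary where [f] has no derivative relative to [a, b]. *)
Definition derive_on (a b : R) (f : R -> R) (x : R) : R :=
  iota (fun l : R => is_derive_on a b f x l).

Fixpoint C_on (n : nat) (a b : R) (f : R -> R) : Prop :=
  (forall x, a <= x <= b -> continue_in f (segment a b) x) /\
  match n with
  | O => True
  | S m => (forall x, a <= x <= b -> ex_derive_on a b f x) /\
           C_on m a b (derive_on a b f)
  end.

(** Breakpoints [a = t 0 < ... < t n = b]; on each closed piece the derivative
    is one-sided at the ends and continuous up to them. *)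
Definition piecewise_smooth (a b : R) (h : R -> R) : Prop :=
  C_on 0 a b h /\
  exists (n : nat) (t : nat -> R),
    t O = a /\ t n = b /\
    forall i : nat, (i < n)%nat ->
      t i < t (S i) /\ C_on 1 (t i) (t (S i)) h.

Definition nonzero_on (a b : R) (h : R -> R) : Prop :=
  exists x, a <= x <= b /\ h x <> 0.

(** Partial derivatives of [F = F(x, y, z)], where [z] stands for [y']. *)

Definition dx (F : R -> R -> R -> R) : R -> R -> R -> R :=
  fun x y z => Derive (fun t => F t y z) x.
Definition dy (F : R -> R -> R -> R) : R -> R -> R -> R :=
  fun x y z => Derive (fun t => F x t z) y.
Definition dz (F : R -> R -> R -> R) : R -> R -> R -> R :=
  fun x y z => Derive (fun t => F x y t) z.

(** All partial derivatives of order at most [n] exist and are continuous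
    on [D], which is meant to be open. *)
Fixpoint C3v (n : nat) (D : R * R * R -> Prop) (F : R -> R -> R -> R) : Prop :=
  (forall x y z, D (x, y, z) ->
     continuous (fun p : R * R * R => F (fst (fst p)) (snd (fst p)) (snd p))
                (x, y, z)) /\
  match n with
  | O => True
  | S m =>
      (forall x y z, D (x, y, z) ->
         ex_derive (fun t => F t y z) x /\
         ex_derive (fun t => F x t z) y /\
         ex_derive (fun t => F x y t) z) /\
      C3v m D (dx F) /\ C3v m D (dy F) /\ C3v m D (dz F)
  end.

Definition along (a b : R) (y : R -> R) (G : R -> R -> R -> R) : R -> R :=
  fun x => G x (y x) (derive_on a b y x).

Definition extremal (a b : R) (F : R -> R -> R -> R) (y : R -> R) : Prop :=
  forall x, a <= x <= b ->
    ex_derive_on a b (along a b y (dz F)) x /\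
    along a b y (dy F) x - derive_on a b (along a b y (dz F)) x = 0.

Definition coefP (a b : R) (F : R -> R -> R -> R) (y : R -> R) : R -> R :=
  along a b y (dz (dz F)).

Definition coefR (a b : R) (F : R -> R -> R -> R) (y : R -> R) : R -> R :=
  along a b y (dy (dz F)).

Definition coefQ (a b : R) (F : R -> R -> R -> R) (y : R -> R) : R -> R :=
  fun x => along a b y (dy (dy F)) x - derive_on a b (coefR a b F y) x.

Definition jacobi_op (a b : R) (P Q u : R -> R) : R -> R :=
  fun x => - derive_on a b (fun s => P s * derive_on a b u s) x + Q x * u x.

Definition jacobi_solution (a b : R) (P Q u : R -> R) : Prop :=
  forall x, a <= x <= b ->
    ex_derive_on a b u x /\
    ex_derive_on a b (fun s => P s * derive_on a b u s) x /\
    jacobi_op a b P Q u x = 0.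

(** For piecewise smooth [h] the integrand has arbitrary values at the finitely
    many corners of [h]; they do not affect the Riemann integral. *)
Definition second_variation (a b : R) (P Q S h : R -> R) : R :=
  (S b * h b ^ 2 - S a * h a ^ 2) +
  RInt (fun x => P x * derive_on a b h x ^ 2 + Q x * h x ^ 2) a b.

Lemma derive_on_unique (a b : R) (f : R -> R) (x l : R) :
  a < b -> a <= x <= b -> is_derive_on a b f x l -> derive_on a b f x = l.
Proof.
intros hab hx hl.
apply (@iota_unique R_AbsRing R_CompleteNormedModule
         (fun l : R => is_derive_on a b f x l)); [|exact hl].
intros m hm.
refine (single_limit _ _ _ _ x _ hm hl).
intros e he.
destruct (Rlt_le_dec x b) as [hxb|hxb].
- set (d := Rmin (e / 2) (b - x)).
  assert (h1 := Rmin_l (e / 2) (b - x)).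
  assert (h2 := Rmin_r (e / 2) (b - x)).
  assert (h3 : 0 < d) by (apply Rmin_glb_lt; lra).
  fold d in h1, h2.
  exists (x + d); split.
  + split; [split|]; lra.
  + unfold Rdist; rewrite Rabs_right; lra.
- set (d := Rmin (e / 2) (x - a)).
  assert (h1 := Rmin_l (e / 2) (x - a)).
  assert (h2 := Rmin_r (e / 2) (x - a)).
  assert (h3 : 0 < d) by (apply Rmin_glb_lt; lra).
  fold d in h1, h2.
  exists (x - d); split.
  + split; [split|]; lra.
  + unfold Rdist; rewrite Rabs_left; lra.
Qed.

(* Main.v *)
Require Import Defs.
From Stdlib Require Import Reals Lra Lia.
From Coquelicot Require Import Coquelicot.
Open Scope R_scope.

(** Put [v = P u'], so that [u' = v / P] and [v' = Q u], with [v(a) = 0]; by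
    uniqueness for this linear system, [u(a) <> 0].
    If [u] has no zero on [a, b], then
      [P h'^2 + Q h^2 = (v h^2 / u)' + P (h' - v h / (P u))^2],
    and the boundary terms vanish, so the second variation is nonnegative and
    is zero only when [h / u] is constant, i.e. [h = 0].
    If [u(c) = 0] with [a < c <= b], then [h = u] on [a, c] and [h = 0] on [c, b]
    is admissible, and its second variation is [u v] taken from [a] to [c],
    that is [0].
    The chain rule for [R] is only needed at interior points: there [Q] coincides
    with a function [L] that is continuous on all of [a, b], and integrals do
    not see the end points. *)

(** * Continuity and derivatives relative to a closed interval *)

Definition cont_on (p q : R) (f : R -> R) : Prop :=
  forall x, p <= x <= q -> continue_in f (segment p q) x.

Lemma continue_in_eps (D : R -> Prop) (f : R -> R) (x : R) :
  continue_in f D x <->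
  forall e, 0 < e -> exists d, 0 < d /\
    forall t, D t -> Rabs (t - x) < d -> Rabs (f t - f x) < e.
Proof.
split; intros H e he; destruct (H e he) as [d [hd Hd]]; exists d; split; auto.
- intros t ht htx. destruct (Req_dec x t) as [->|n].
  + unfold Rminus; rewrite Rplus_opp_r, Rabs_R0; lra.
  + apply (Hd t); repeat split; auto.
- intros t [[ht _] htx]. apply Hd; auto.
Qed.

Lemma continuity_pt_continue_in (D : R -> Prop) (f : R -> R) (x : R) :
  continuity_pt f x -> continue_in f D x.
Proof.
intros H e he. destruct (H e he) as [d [hd Hd]]. exists d; split; auto.
intros t [[_ n] ht]. apply Hd. repeat split; auto.
Qed.

(** Fewer competing points only weaken the limit condition. This carries derivatives from [[a, b]]
    to a subinterval, where the function may also be replaced by one that agrees with it there. *)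
Lemma is_derive_on_sub (a b p q : R) (f g : R -> R) (x l : R) :
  a <= p -> q <= b -> p <= x <= q ->
  (forall t, p <= t <= q -> g t = f t) ->
  is_derive_on a b f x l -> is_derive_on p q g x l.
Proof.
intros hp hq hx hfg H e he.
destruct (H e he) as [d [hd Hd]]; exists d; split; auto.
intros t [[ht n] htx].
rewrite (hfg t ht), (hfg x hx).
apply Hd; repeat split; auto; destruct ht; lra.
Qed.

(** Increments smaller than the distance to both ends stay inside [[a, b]]. This is the bridge to
    ordinary differential calculus, and it serves only at interior points. *)
Lemma is_derive_on_interior (a b : R) (f : R -> R) (x l : R) :
  a < x < b -> (is_derive_on a b f x l <-> is_derive f x l).
Proof.
intros hx; split; intros H.
- apply is_derive_Reals. intros e he.
  destruct (H e he) as [d [hd Hd]].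
  assert (hm : 0 < Rmin d (Rmin (x - a) (b - x))).
  { repeat apply Rmin_glb_lt; lra. }
  exists (mkposreal _ hm). intros k hk hkm. simpl in hkm.
  assert (h1 := Rmin_l d (Rmin (x - a) (b - x))).
  assert (h2 := Rmin_r d (Rmin (x - a) (b - x))).
  assert (h3 := Rmin_l (x - a) (b - x)).
  assert (h4 := Rmin_r (x - a) (b - x)).
  assert (h5 := Rabs_def2 _ _ hkm).
  specialize (Hd (x + k)). simpl in Hd; unfold Rdist in Hd.
  replace (x + k - x) with k in Hd by ring.
  apply Hd. split; [split; [split; lra|lra]|lra].
- apply is_derive_Reals in H. intros e he.
  destruct (H e he) as [d Hd]. exists d; split; [apply cond_pos|].
  intros t [[ht n] htx]. simpl in *. unfold Rdist in *.
  specialize (Hd (t - x)). replace (x + (t - x)) with t in Hd by ring.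
  apply Hd; auto. lra.
Qed.

Lemma is_derive_on_derive_on (a b : R) (f : R -> R) (x : R) :
  a < b -> a <= x <= b -> ex_derive_on a b f x ->
  is_derive_on a b f x (derive_on a b f x).
Proof.
intros hab hx [l hl]. rewrite (derive_on_unique a b f x l); auto.
Qed.

Lemma is_derive_on_continue (a b : R) (f : R -> R) (x l : R) :
  is_derive_on a b f x l -> continue_in f (segment a b) x.
Proof. apply cont_deriv. Qed.

Lemma cont_on_sub (a b p q : R) (f g : R -> R) :
  a <= p -> q <= b -> (forall t, p <= t <= q -> g t = f t) ->
  cont_on a b f -> cont_on p q g.
Proof.
intros hp hq hfg H x hx. apply continue_in_eps; intros e he.
destruct (proj1 (continue_in_eps _ _ _) (H x ltac:(lra)) e he) as [d [hd Hd]].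
exists d; split; auto. intros t ht. rewrite (hfg t ht), (hfg x hx).
apply Hd. destruct ht; split; lra.
Qed.

Lemma cont_on_const (p q c : R) : cont_on p q (fun _ => c).
Proof.
intros x hx. apply continue_in_eps; intros e he. exists 1; split; [lra|].
intros t _ _. rewrite Rminus_diag, Rabs_R0; lra.
Qed.

Lemma cont_on_plus (p q : R) (f g : R -> R) :
  cont_on p q f -> cont_on p q g -> cont_on p q (fun x => f x + g x).
Proof. intros hf hg x hx. apply limit_plus; [apply hf|apply hg]; auto. Qed.

Lemma cont_on_minus (p q : R) (f g : R -> R) :
  cont_on p q f -> cont_on p q g -> cont_on p q (fun x => f x - g x).
Proof. intros hf hg x hx. apply limit_minus; [apply hf|apply hg]; auto. Qed.

Lemma cont_on_mult (p q : R) (f g : R -> R) :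
  cont_on p q f -> cont_on p q g -> cont_on p q (fun x => f x * g x).
Proof. intros hf hg x hx. apply limit_mul; [apply hf|apply hg]; auto. Qed.

Lemma cont_on_sqr (p q : R) (f : R -> R) :
  cont_on p q f -> cont_on p q (fun x => f x ^ 2).
Proof.
intros hf. simpl. apply cont_on_mult; auto.
apply cont_on_mult; auto using cont_on_const.
Qed.

Lemma cont_on_div (p q : R) (f g : R -> R) :
  cont_on p q f -> cont_on p q g -> (forall x, p <= x <= q -> g x <> 0) ->
  cont_on p q (fun x => f x / g x).
Proof.
intros hf hg h0. apply cont_on_mult; auto.
intros x hx. apply limit_inv; [apply hg|]; auto.
Qed.

(** * Mean value theorem and integrals on a closed interval *)

(** The projection of the line onto [[p, q]]. Composing with it extends a function continuous on
    [[p, q]] to one continuous everywhere, to which two-sided theorems apply. *)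
Definition clamp (p q x : R) : R := Rmax p (Rmin x q).

Lemma clamp_in (p q x : R) : p <= q -> p <= clamp p q x <= q.
Proof. intros. unfold clamp, Rmax, Rmin; repeat destruct Rle_dec; lra. Qed.

Lemma clamp_id (p q x : R) : p <= x <= q -> clamp p q x = x.
Proof. intros. unfold clamp, Rmax, Rmin; repeat destruct Rle_dec; lra. Qed.

Lemma clamp_lipschitz (p q x t : R) :
  p <= q -> Rabs (clamp p q t - clamp p q x) <= Rabs (t - x).
Proof.
intros. unfold clamp, Rmax, Rmin; repeat destruct Rle_dec;
unfold Rabs; repeat destruct Rcase_abs; lra.
Qed.

Lemma cont_on_clamp (p q : R) (f : R -> R) (x : R) :
  p <= q -> cont_on p q f -> continuity_pt (fun t => f (clamp p q t)) x.
Proof.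
intros hpq H e he.
destruct (proj1 (continue_in_eps _ _ _) (H _ (clamp_in p q x hpq)) e he)
  as [d [hd Hd]].
exists d; split; auto. intros t [_ ht]. simpl in *. unfold Rdist in *.
apply Hd; [apply clamp_in; auto|].
eapply Rle_lt_trans; [apply clamp_lipschitz; auto|auto].
Qed.

Lemma is_derive_clamp (p q : R) (f : R -> R) (x l : R) :
  p < x < q -> is_derive f x l -> is_derive (fun t => f (clamp p q t)) x l.
Proof.
intros hx. apply is_derive_ext_loc.
apply (locally_interval _ x p q); try (simpl; lra).
intros t h1 h2; simpl in *. rewrite clamp_id; auto; lra.
Qed.

(** The classical theorem is applied to the clamped function, which has the same derivative inside
    and the same values at the ends. *)
Lemma MVT_on (p q : R) (f f' : R -> R) :
  p < q -> cont_on p q f -> (forall x, p < x < q -> is_derive f x (f' x)) ->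
  exists c, p < c < q /\ f q - f p = f' c * (q - p).
Proof.
intros hpq hc hd.
set (g := fun t => f (clamp p q t)).
assert (hg : forall x, p < x < q -> derivable_pt_lim g x (f' x)).
{ intros x hx. apply is_derive_Reals, is_derive_clamp; auto. }
destruct (MVT g id p q (fun x hx => exist _ (f' x) (hg x hx))
  (fun x _ => derivable_pt_id x) hpq
  (fun x _ => cont_on_clamp p q f x (Rlt_le _ _ hpq) hc)
  (fun x _ => derivable_continuous_pt _ _ (derivable_pt_id x)))
  as [c [hcc E]].
exists c; split; auto.
rewrite derive_pt_id in E. simpl in E. unfold id, g in E.
rewrite !clamp_id in E by lra. lra.
Qed.

(** The primitive of the clamped [f'] minus [f] has derivative [0] inside, so by the mean value
    theorem it takes equal values at the ends. Differentiability of [f] is asked only in the open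
    interval. *)
Lemma FTC_on (p q : R) (f f' : R -> R) :
  p < q -> cont_on p q f -> cont_on p q f' ->
  (forall x, p < x < q -> is_derive f x (f' x)) ->
  is_RInt f' p q (f q - f p).
Proof.
intros hpq hf hf' hd.
set (g := fun t => f' (clamp p q t)).
assert (hg : forall x, continuous g x).
{ intros x. apply continuity_pt_filterlim, cont_on_clamp; auto; lra. }
assert (hI : forall x, is_RInt g p x (RInt g p x)).
{ intros x. apply (@RInt_correct R_CompleteNormedModule), (@ex_RInt_continuous R_CompleteNormedModule). auto. }
assert (hG : forall x, is_derive (fun t => RInt g p t) x (g x)).
{ intros x. apply (is_derive_RInt g _ p); auto.
  exists (mkposreal 1 Rlt_0_1); auto. }
destruct (MVT_on p q (fun t => RInt g p t - f t) (fun _ => 0))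
  as [c [_ E]]; auto.
- apply cont_on_minus; auto. intros x _. apply continuity_pt_continue_in.
  apply derivable_continuous_pt. exists (g x).
  apply is_derive_Reals, hG.
- intros x hx. evar_last.
  + apply @is_derive_minus; [apply hG|apply hd; auto].
  + unfold g. rewrite clamp_id by lra. apply (minus_eq_zero (f' x)).
- rewrite RInt_point in E. unfold zero in E; simpl in E.
  replace (f q - f p) with (RInt g p q) by lra.
  apply is_RInt_ext with g; auto.
  rewrite Rmin_left, Rmax_right by lra.
  intros x hx. unfold g. rewrite clamp_id; auto; lra.
Qed.

Lemma nonincreasing_on (p q : R) (f f' : R -> R) :
  p <= q -> cont_on p q f ->
  (forall x, p < x < q -> is_derive f x (f' x) /\ f' x <= 0) -> f q <= f p.
Proof.
intros hpq hf hd. destruct (Req_dec p q) as [->|n]; [lra|].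
destruct (MVT_on p q f f') as [c [hc E]]; auto; [lra|apply hd|].
assert (h := proj2 (hd c hc)). nra.
Qed.

Lemma constant_on (p q : R) (f : R -> R) :
  cont_on p q f -> (forall x, p < x < q -> is_derive f x 0) ->
  forall x, p <= x <= q -> f x = f p.
Proof.
intros hf hd x hx. destruct (Req_dec p x) as [->|n]; auto.
destruct (MVT_on p x f (fun _ => 0)) as [c [hc E]]; try lra.
- apply (cont_on_sub p q p x f f); auto; lra.
- intros t ht; apply hd; lra.
Qed.

Lemma ex_RInt_on (p q : R) (f : R -> R) :
  p < q -> cont_on p q f -> ex_RInt f p q.
Proof.
intros hpq hf.
apply ex_RInt_ext with (fun t => f (clamp p q t)).
- rewrite Rmin_left, Rmax_right by lra. intros x hx. rewrite clamp_id; auto; lra.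
- apply (@ex_RInt_continuous R_CompleteNormedModule).
  intros x _. apply continuity_pt_filterlim, cont_on_clamp; auto; lra.
Qed.

(** The integrals over [[p, x]] and [[x, q]] are nonnegative with sum [0], so the primitive vanishes
    on the open interval, and with it its derivative, the integrand. *)
Lemma RInt_eq_0_on (p q : R) (f : R -> R) :
  p < q -> cont_on p q f -> (forall x, p <= x <= q -> 0 <= f x) ->
  RInt f p q = 0 -> forall x, p < x < q -> f x = 0.
Proof.
intros hpq hf h0 hI.
set (g := fun t => f (clamp p q t)).
assert (hg : forall x, continuous g x).
{ intros x. apply continuity_pt_filterlim, cont_on_clamp; auto; lra. }
assert (g0 : forall x, 0 <= g x).
{ intros x. apply h0, clamp_in; lra. }
assert (hE : forall s t, ex_RInt g s t).
{ intros s t. apply (@ex_RInt_continuous R_CompleteNormedModule). auto. }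
assert (hI' : RInt g p q = 0).
{ rewrite <- hI. apply RInt_ext. rewrite Rmin_left, Rmax_right by lra.
  intros x hx. unfold g. rewrite clamp_id; auto; lra. }
assert (hz : forall x, p < x < q -> RInt g p x = 0).
{ intros x hx.
  assert (E := RInt_Chasles g p x q (hE _ _) (hE _ _)).
  assert (h1 := RInt_ge_0 g p x (Rlt_le _ _ (proj1 hx)) (hE _ _) (fun t _ => g0 t)).
  assert (h2 := RInt_ge_0 g x q (Rlt_le _ _ (proj2 hx)) (hE _ _) (fun t _ => g0 t)).
  unfold plus in E; simpl in E. lra. }
intros x hx.
assert (hG : is_derive (fun t => RInt g p t) x (g x)).
{ apply (is_derive_RInt g _ p); auto.
  exists (mkposreal 1 Rlt_0_1). intros t _.
  apply (@RInt_correct R_CompleteNormedModule); auto. }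
replace (f x) with (g x) by (unfold g; rewrite clamp_id; auto; lra).
rewrite <- (is_derive_unique _ _ _ hG).
rewrite (Derive_ext_loc _ (fun _ => 0)); [apply Derive_const|].
apply (locally_interval _ x p q); try (simpl; lra).
intros t h1 h2; apply hz; simpl in *; lra.
Qed.

(** * Uniqueness for the linear first-order system *)

Lemma bounded_on (p q : R) (f : R -> R) :
  p <= q -> cont_on p q f ->
  exists K, forall x, p <= x <= q -> Rabs (f x) <= K.
Proof.
intros hpq hf.
set (g := fun t => f (clamp p q t)).
assert (hg : forall x, p <= x <= q -> continuity_pt g x).
{ intros x _. apply cont_on_clamp; auto. }
destruct (continuity_ab_maj g p q hpq hg) as [M [hM _]].
destruct (continuity_ab_min g p q hpq hg) as [m [hm _]].
exists (Rmax (Rabs (g M)) (Rabs (g m))). intros x hx.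
specialize (hM x hx). specialize (hm x hx).
replace (f x) with (g x) by (unfold g; rewrite clamp_id; auto).
unfold Rmax; destruct Rle_dec; unfold Rabs in *; repeat destruct Rcase_abs; lra.
Qed.

(* Gronwall: [(u^2 + v^2) exp (- K x)] is nonincreasing when [|1/P + L| <= K]. *)
Lemma linear_system_unique (a b : R) (P L u v : R -> R) :
  cont_on a b P -> cont_on a b L -> cont_on a b u -> cont_on a b v ->
  (forall x, a <= x <= b -> 0 < P x) ->
  (forall x, a < x < b -> is_derive u x (v x / P x)) ->
  (forall x, a < x < b -> is_derive v x (L x * u x)) ->
  u a = 0 -> v a = 0 -> forall x, a <= x <= b -> u x = 0.
Proof.
intros cP cL cu cv hP hu hv ua va x hx.
set (m := fun s => 1 / P s + L s).
assert (cm : cont_on a b m).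
{ apply cont_on_plus; auto. apply cont_on_div; auto using cont_on_const.
  intros s hs. specialize (hP s hs). lra. }
destruct (bounded_on a b m ltac:(lra) cm) as [K hK].
set (E := fun s => (u s ^ 2 + v s ^ 2) * exp (- K * s)).
assert (hE : E x <= E a).
{ apply (nonincreasing_on a x E (fun s =>
    (2 * u s * v s * m s - K * (u s ^ 2 + v s ^ 2)) * exp (- K * s))); [lra| |].
  - apply (cont_on_sub a b a x E E); auto; try lra.
    apply cont_on_mult.
    + apply cont_on_plus; apply cont_on_sqr; auto.
    + intros s _. apply continuity_pt_continue_in. reg.
  - intros s hs. split.
    + unfold E, m. assert (hp := hP s ltac:(lra)).
      specialize (hu s ltac:(lra)). specialize (hv s ltac:(lra)).
      auto_derive.
      * repeat split; eexists; eauto.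
      * change (Derive (fun t => u t) s) with (Derive u s).
        change (Derive (fun t => v t) s) with (Derive v s).
        rewrite (is_derive_unique _ _ _ hu), (is_derive_unique _ _ _ hv).
        field. lra.
    + assert (h := hK s ltac:(lra)).
      assert (h1 := exp_pos (- K * s)).
      assert (- K <= m s <= K) by (apply Rabs_le_between; auto).
      (* The two squares give [|2 u v| <= u^2 + v^2]; with [|m| <= K] this makes the derivative
         nonpositive. *)
      assert (0 <= (u s - v s) ^ 2) by apply pow2_ge_0.
      assert (0 <= (u s + v s) ^ 2) by apply pow2_ge_0.
      assert (2 * u s * v s * m s - K * (u s ^ 2 + v s ^ 2) <= 0) by nra.
      nra. }
unfold E in hE. rewrite ua, va in hE.
assert (h1 := exp_pos (- K * x)).
assert (0 <= u x ^ 2) by apply pow2_ge_0.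
assert (0 <= v x ^ 2) by apply pow2_ge_0.
assert (u x ^ 2 + v x ^ 2 <= 0) by nra.
nra.
Qed.

(** * The chain rule for a function of three variables *)

(** The division-free form makes sense at [t = x] too, and such error bounds can simply be added. *)
Lemma is_derive_eps (f : R -> R) (x l : R) :
  is_derive f x l <->
  forall e, 0 < e -> exists d, 0 < d /\
    forall t, Rabs (t - x) < d ->
      Rabs (f t - f x - l * (t - x)) <= e * Rabs (t - x).
Proof.
split.
- intros H e he. apply is_derive_Reals in H.
  destruct (H e he) as [d Hd]. exists d; split; [apply cond_pos|].
  intros t ht. destruct (Req_dec t x) as [->|n].
  + rewrite !Rminus_diag, Rmult_0_r, Rminus_diag, Rabs_R0. lra.
  + specialize (Hd (t - x) ltac:(lra) ht).
    replace (x + (t - x)) with t in Hd by ring.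
    replace (f t - f x - l * (t - x)) with (((f t - f x) / (t - x) - l) * (t - x))
      by (field; lra).
    rewrite Rabs_mult. apply Rmult_le_compat_r; [apply Rabs_pos|lra].
- intros H. apply is_derive_Reals. intros e he.
  (* Halving [e] turns the weak inequality into the strict one required by the limit. *)
  destruct (H (e / 2) ltac:(lra)) as [d [hd Hd]].
  exists (mkposreal d hd). intros k hk hkd. simpl in hkd.
  specialize (Hd (x + k)). replace (x + k - x) with k in Hd by ring.
  replace ((f (x + k) - f x) / k - l) with ((f (x + k) - f x - l * k) / k)
    by (field; auto).
  assert (h := Rabs_pos_lt k hk).
  unfold Rdiv. rewrite Rabs_mult, Rabs_inv.
  apply Rle_lt_trans with (e / 2); [|lra].
  apply Rmult_le_reg_r with (Rabs k); auto.
  rewrite Rmult_assoc, Rinv_l, Rmult_1_r by lra. auto.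
Qed.

(** By the mean value theorem the increment is [g' r * (t - s)] for an intermediate [r]. [Rmin] and
    [Rmax] allow [t] on either side of [s]. *)
Lemma increment_bound (g g' : R -> R) (s t c e : R) :
  (forall r, Rmin s t <= r <= Rmax s t ->
     is_derive g r (g' r) /\ Rabs (g' r - c) <= e) ->
  Rabs (g t - g s - c * (t - s)) <= e * Rabs (t - s).
Proof.
intros H.
destruct (MVT_gen g s t g') as [r [hr E]].
- intros r hr. apply H; lra.
- intros r hr. apply derivable_continuous_pt. exists (g' r).
  apply is_derive_Reals, H; auto.
- rewrite E. replace (g' r * (t - s) - c * (t - s)) with ((g' r - c) * (t - s))
    by ring.
  rewrite Rabs_mult. apply Rmult_le_compat_r; [apply Rabs_pos|apply H; auto].
Qed.

(** The ball of the product uniform structure on [R * R * R], written by components: an open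
    cube. *)
Definition near3 (d x y z p q r : R) : Prop :=
  Rabs (p - x) < d /\ Rabs (q - y) < d /\ Rabs (r - z) < d.

Lemma open_near3 (D : R * R * R -> Prop) (x y z : R) :
  open D -> D (x, y, z) ->
  exists d, 0 < d /\ forall p q r, near3 d x y z p q r -> D (p, q, r).
Proof.
intros hD h. destruct (hD _ h) as [d Hd]. exists d; split; [apply cond_pos|].
intros p q r [h1 [h2 h3]]. apply Hd. repeat split; simpl; auto.
Qed.

Lemma continuous_near3 (H : R -> R -> R -> R) (x y z : R) :
  continuous (fun p : R * R * R => H (fst (fst p)) (snd (fst p)) (snd p)) (x, y, z) ->
  forall e, 0 < e -> exists d, 0 < d /\
    forall p q r, near3 d x y z p q r -> Rabs (H p q r - H x y z) < e.
Proof.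
intros hc e he.
destruct (proj1 (filterlim_locally _ _) hc (mkposreal e he)) as [d Hd].
exists d; split; [apply cond_pos|].
intros p q r [h1 [h2 h3]]. apply (Hd (p, q, r)). repeat split; simpl; auto.
Qed.

(** Continuous partial derivatives give differentiability: the increment is split along [(x, y, z)],
    [(x, y, r)], [(x, q, r)], [(p, q, r)], and on each leg a single partial derivative is within [e]
    of its value at [(x, y, z)]. *)
Lemma C3v_differentiable (D : R * R * R -> Prop) (G : R -> R -> R -> R) (x y z : R) :
  open D -> C3v 1 D G -> D (x, y, z) ->
  forall e, 0 < e -> exists d, 0 < d /\
    forall p q r, near3 d x y z p q r ->
      Rabs (G p q r - G x y z
            - (dx G x y z * (p - x) + dy G x y z * (q - y) + dz G x y z * (r - z)))
      <= e * (Rabs (p - x) + Rabs (q - y) + Rabs (r - z)).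
Proof.
intros hD [_ [hG [[hx _] [[hy _] [hz _]]]]] h e he.
destruct (open_near3 D x y z hD h) as [d0 [h0 H0]].
destruct (continuous_near3 _ _ _ _ (hx _ _ _ h) e he) as [d1 [h1 H1]].
destruct (continuous_near3 _ _ _ _ (hy _ _ _ h) e he) as [d2 [h2 H2]].
destruct (continuous_near3 _ _ _ _ (hz _ _ _ h) e he) as [d3 [h3 H3]].
exists (Rmin (Rmin d0 d1) (Rmin d2 d3)). split; [repeat apply Rmin_glb_lt; auto|].
set (d := Rmin _ _).
assert (hd : d <= d0 /\ d <= d1 /\ d <= d2 /\ d <= d3).
{ unfold d. assert (k1 := Rmin_l d0 d1). assert (k2 := Rmin_r d0 d1).
  assert (k3 := Rmin_l d2 d3). assert (k4 := Rmin_r d2 d3).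
  assert (k5 := Rmin_l (Rmin d0 d1) (Rmin d2 d3)).
  assert (k6 := Rmin_r (Rmin d0 d1) (Rmin d2 d3)). lra. }
assert (d_pos : 0 < d) by (unfold d; repeat apply Rmin_glb_lt; auto).
clearbody d.
intros p q r [k1 [k2 k3]].
(* Every leg stays in the cube, where all three partial derivatives are controlled. *)
assert (between : forall s t w, Rabs (t - s) < d -> Rmin s t <= w <= Rmax s t ->
  Rabs (w - s) < d).
{ intros s t w. unfold Rmin, Rmax. destruct Rle_dec; unfold Rabs;
  repeat destruct Rcase_abs; lra. }
assert (zero : forall s, Rabs (s - s) < d).
{ intros s. rewrite Rminus_diag, Rabs_R0; auto. }
assert (near : forall d' p q r, d <= d' ->
  Rabs (p - x) < d -> Rabs (q - y) < d -> Rabs (r - z) < d -> near3 d' x y z p q r).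
{ intros d' p' q' r' n1 n2 n3 n4; repeat split; lra. }
assert (E1 : Rabs (G p q r - G x q r - dx G x y z * (p - x)) <= e * Rabs (p - x)).
{ apply (increment_bound (fun t => G t q r) (fun t => dx G t q r)).
  intros t ht. specialize (between _ _ _ k1 ht). split.
  - apply Derive_correct. apply (hG t q r (H0 _ _ _ (near _ _ _ _ (proj1 hd) between k2 k3))).
  - apply Rlt_le, (H1 t q r (near _ _ _ _ (proj1 (proj2 hd)) between k2 k3)). }
assert (E2 : Rabs (G x q r - G x y r - dy G x y z * (q - y)) <= e * Rabs (q - y)).
{ apply (increment_bound (fun t => G x t r) (fun t => dy G x t r)).
  intros t ht. specialize (between _ _ _ k2 ht). split.
  - apply Derive_correct. apply (hG x t r (H0 _ _ _ (near _ _ _ _ (proj1 hd) (zero x) between k3))).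
  - apply Rlt_le, (H2 x t r (near _ _ _ _ (proj1 (proj2 (proj2 hd))) (zero x) between k3)). }
assert (E3 : Rabs (G x y r - G x y z - dz G x y z * (r - z)) <= e * Rabs (r - z)).
{ apply (increment_bound (fun t => G x y t) (fun t => dz G x y t)).
  intros t ht. specialize (between _ _ _ k3 ht). split.
  - apply Derive_correct. apply (hG x y t (H0 _ _ _ (near _ _ _ _ (proj1 hd) (zero x) (zero y) between))).
  - apply Rlt_le, (H3 x y t (near _ _ _ _ (proj2 (proj2 (proj2 hd))) (zero x) (zero y) between)). }
replace (G p q r - G x y z - _) with
  ((G p q r - G x q r - dx G x y z * (p - x)) +
   ((G x q r - G x y r - dy G x y z * (q - y)) +
    (G x y r - G x y z - dz G x y z * (r - z)))) by ring.
eapply Rle_trans; [apply Rabs_triang|].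
assert (T := Rabs_triang (G x q r - G x y r - dy G x y z * (q - y))
  (G x y r - G x y z - dz G x y z * (r - z))). lra.
Qed.

(** The first bound keeps the inner functions of a composition in the cube where the outer estimate
    holds; the second makes their increments comparable to [t - x]. *)
Lemma is_derive_small (f : R -> R) (x l d : R) :
  is_derive f x l -> 0 < d ->
  exists d', 0 < d' /\ forall t, Rabs (t - x) < d' ->
    Rabs (f t - f x) < d /\ Rabs (f t - f x) <= (Rabs l + 1) * Rabs (t - x).
Proof.
intros H hd.
destruct (proj1 (is_derive_eps f x l) H 1 Rlt_0_1) as [d1 [h1 H1]].
assert (hl := Rabs_pos l).
assert (hm : 0 < Rmin d1 (d / (Rabs l + 1))).
{ apply Rmin_glb_lt; auto. apply Rdiv_lt_0_compat; lra. }
exists (Rmin d1 (d / (Rabs l + 1))). split; auto.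
intros t ht.
assert (m1 := Rmin_l d1 (d / (Rabs l + 1))).
assert (m2 := Rmin_r d1 (d / (Rabs l + 1))).
specialize (H1 t ltac:(lra)).
assert (k : Rabs (f t - f x) <= (Rabs l + 1) * Rabs (t - x)).
{ replace (f t - f x) with ((f t - f x - l * (t - x)) + l * (t - x)) by ring.
  eapply Rle_trans; [apply Rabs_triang|]. rewrite (Rabs_mult l). lra. }
split; auto. eapply Rle_lt_trans; [exact k|].
apply Rlt_le_trans with ((Rabs l + 1) * (d / (Rabs l + 1))).
- apply Rmult_lt_compat_l; lra.
- right; field; lra.
Qed.

Lemma is_derive_comp3 (D : R * R * R -> Prop) (G : R -> R -> R -> R)
    (y z : R -> R) (x y' z' : R) :
  open D -> C3v 1 D G -> D (x, y x, z x) ->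
  is_derive y x y' -> is_derive z x z' ->
  is_derive (fun t => G t (y t) (z t)) x
    (dx G x (y x) (z x) + dy G x (y x) (z x) * y' + dz G x (y x) (z x) * z').
Proof.
intros hD hG h hy hz. apply is_derive_eps. intros e he.
set (gx := dx G _ _ _). set (gy := dy G _ _ _). set (gz := dz G _ _ _).
assert (py := Rabs_pos y'). assert (pz := Rabs_pos z').
assert (qy := Rabs_pos gy). assert (qz := Rabs_pos gz).
(* The increments of [t], [y] and [z] add up to at most [1 + (|y'| + 1) + (|z'| + 1) = m] times
   [|t - x|]. The linearization errors of [y] and [z] enter with weights [|gy|] and [|gz|], and the
   extra [1] keeps [n] positive. Each source of error thus costs [e / 2]. *)
set (m := Rabs y' + Rabs z' + 3).
set (n := Rabs gy + Rabs gz + 1).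
assert (e1 : 0 < e / 2 / m) by (apply Rdiv_lt_0_compat; unfold m; lra).
assert (e2 : 0 < e / 2 / n) by (apply Rdiv_lt_0_compat; unfold n; lra).
destruct (C3v_differentiable D G _ _ _ hD hG h _ e1) as [d0 [h0 H0]].
destruct (proj1 (is_derive_eps _ _ _) hy _ e2) as [d1 [h1 H1]].
destruct (proj1 (is_derive_eps _ _ _) hz _ e2) as [d2 [h2 H2]].
destruct (is_derive_small _ _ _ _ hy h0) as [d3 [h3 H3]].
destruct (is_derive_small _ _ _ _ hz h0) as [d4 [h4 H4]].
exists (Rmin d0 (Rmin (Rmin d1 d2) (Rmin d3 d4))).
split; [repeat apply Rmin_glb_lt; auto|]. intros t ht.
assert (k1 : Rabs (t - x) < d0) by (eapply Rlt_le_trans; [exact ht|apply Rmin_l]).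
apply Rlt_le_trans with (2 := Rmin_r _ _) in ht.
assert (ht' := Rlt_le_trans _ _ _ ht (Rmin_l _ _)).
apply Rlt_le_trans with (2 := Rmin_r _ _) in ht.
specialize (H1 t (Rlt_le_trans _ _ _ ht' (Rmin_l _ _))).
specialize (H2 t (Rlt_le_trans _ _ _ ht' (Rmin_r _ _))).
destruct (H3 t (Rlt_le_trans _ _ _ ht (Rmin_l _ _))) as [k2 K2].
destruct (H4 t (Rlt_le_trans _ _ _ ht (Rmin_r _ _))) as [k3 K3].
specialize (H0 t (y t) (z t) (conj k1 (conj k2 k3))).
fold gx gy gz in H0.
set (T := Rabs (t - x)) in *. assert (pT : 0 <= T) by apply Rabs_pos.
replace (G t (y t) (z t) - G x (y x) (z x) - _) with
  ((G t (y t) (z t) - G x (y x) (z x)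
     - (gx * (t - x) + gy * (y t - y x) + gz * (z t - z x)))
   + (gy * (y t - y x - y' * (t - x)) + gz * (z t - z x - z' * (t - x)))) by ring.
eapply Rle_trans; [apply Rabs_triang|].
assert (A1 : Rabs (gy * (y t - y x - y' * (t - x)) + gz * (z t - z x - z' * (t - x)))
  <= e / 2 / n * n * T).
{ eapply Rle_trans; [apply Rabs_triang|]. rewrite !Rabs_mult.
  assert (B1 := Rmult_le_compat_l _ _ _ qy H1).
  assert (B2 := Rmult_le_compat_l _ _ _ qz H2).
  assert (0 <= e / 2 / n * T) by (apply Rmult_le_pos; lra).
  unfold n at 2. lra. }
assert (A2 : e / 2 / m * (T + Rabs (y t - y x) + Rabs (z t - z x)) <= e / 2 / m * m * T).
{ rewrite Rmult_assoc. apply Rmult_le_compat_l; [lra|]. unfold m. lra. }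
replace (e / 2 / n * n) with (e / 2) in A1 by (field; unfold n; lra).
replace (e / 2 / m * m) with (e / 2) in A2 by (field; unfold m; lra).
lra.
Qed.

Lemma cont_on_comp3 (a b : R) (D : R * R * R -> Prop) (G : R -> R -> R -> R)
    (y z : R -> R) :
  C3v 0 D G -> (forall x, a <= x <= b -> D (x, y x, z x)) ->
  cont_on a b y -> cont_on a b z -> cont_on a b (fun x => G x (y x) (z x)).
Proof.
intros [hG _] hD hy hz x hx. apply continue_in_eps. intros e he.
destruct (continuous_near3 _ _ _ _ (hG _ _ _ (hD x hx)) e he) as [d [hd Hd]].
destruct (proj1 (continue_in_eps _ _ _) (hy x hx) d hd) as [d1 [h1 H1]].
destruct (proj1 (continue_in_eps _ _ _) (hz x hx) d hd) as [d2 [h2 H2]].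
exists (Rmin d (Rmin d1 d2)). split; [repeat apply Rmin_glb_lt; auto|].
intros t ht k.
assert (m1 := Rmin_l d (Rmin d1 d2)). assert (m2 := Rmin_r d (Rmin d1 d2)).
assert (m3 := Rmin_l d1 d2). assert (m4 := Rmin_r d1 d2).
apply Hd. repeat split; [lra|apply H1; auto; lra|apply H2; auto; lra].
Qed.

Lemma C3v_0 (n : nat) (D : R * R * R -> Prop) (G : R -> R -> R -> R) :
  C3v n D G -> C3v 0 D G.
Proof. destruct n; intros H; [auto|split; [apply H|trivial]]. Qed.

(** * Lower bound for the quadratic functional when [u] has no zero *)

(** The quotient [w = v / u] solves the Riccati equation [w' = L - w^2 / P], so the integrand is
    [W' + psi] with [psi >= 0]. If the integral of [psi] vanishes, so does [psi] inside, whence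
    [h' = h u' / u] and [h / u] is constant. *)
Lemma Riccati_piece (p q : R) (P L u v h h' : R -> R) :
  p < q -> cont_on p q P -> cont_on p q L -> cont_on p q u -> cont_on p q v ->
  cont_on p q h -> cont_on p q h' ->
  (forall x, p <= x <= q -> 0 < P x) ->
  (forall x, p <= x <= q -> u x <> 0) ->
  (forall x, p < x < q -> is_derive u x (v x / P x)) ->
  (forall x, p < x < q -> is_derive v x (L x * u x)) ->
  (forall x, p < x < q -> is_derive h x (h' x)) ->
  exists V : R, is_RInt (fun x => P x * h' x ^ 2 + L x * h x ^ 2) p q V /\
    v q / u q * h q ^ 2 - v p / u p * h p ^ 2 <= V /\
    (V = v q / u q * h q ^ 2 - v p / u p * h p ^ 2 ->
     forall x, p <= x <= q -> h x / u x = h p / u p).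
Proof.
intros hpq cP cL cu cv ch ch' hP hu0 hu hv hh.
set (W := fun x => v x / u x * h x ^ 2).
set (psi := fun x => P x * (h' x - v x * h x / (P x * u x)) ^ 2).
assert (cPu : cont_on p q (fun x => v x * h x / (P x * u x))).
{ apply cont_on_div; auto using cont_on_mult. intros x hx.
  apply Rmult_integral_contrapositive_currified; auto.
  specialize (hP x hx); lra. }
assert (cpsi : cont_on p q psi).
{ apply cont_on_mult; auto. apply cont_on_sqr, cont_on_minus; auto. }
assert (cphi : cont_on p q (fun x => P x * h' x ^ 2 + L x * h x ^ 2)).
{ apply cont_on_plus; apply cont_on_mult; auto using cont_on_sqr. }
assert (IW : is_RInt (fun x => P x * h' x ^ 2 + L x * h x ^ 2 - psi x) p q (W q - W p)).
{ apply FTC_on; auto.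
  - apply cont_on_mult; auto using cont_on_div, cont_on_sqr.
  - apply cont_on_minus; auto.
  - intros x hx. assert (k := hP x ltac:(lra)). assert (k0 := hu0 x ltac:(lra)).
    specialize (hu x hx). specialize (hv x hx). specialize (hh x hx).
    unfold W, psi. auto_derive.
    + repeat split; auto; eexists; eauto.
    + change (Derive (fun t => u t) x) with (Derive u x).
      change (Derive (fun t => v t) x) with (Derive v x).
      change (Derive (fun t => h t) x) with (Derive h x).
      rewrite (is_derive_unique _ _ _ hu), (is_derive_unique _ _ _ hv),
        (is_derive_unique _ _ _ hh).
      field. lra. }
assert (Ipsi : is_RInt psi p q (RInt psi p q)).
{ apply (@RInt_correct R_CompleteNormedModule), ex_RInt_on; auto. }
assert (psi_ge0 : forall x, p <= x <= q -> 0 <= psi x).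
{ intros x hx. apply Rmult_le_pos; [apply Rlt_le; auto|apply pow2_ge_0]. }
exists (W q - W p + RInt psi p q). split; [|split].
- eapply is_RInt_ext; [|exact (is_RInt_plus _ _ _ _ _ _ IW Ipsi)].
  intros x _. unfold plus; simpl. ring.
- assert (0 <= RInt psi p q).
  { apply RInt_ge_0; [lra|apply ex_RInt_on; auto|].
    intros x hx; apply psi_ge0; lra. }
  unfold W in *. lra.
- intros E x hx.
  assert (E' : RInt psi p q = 0) by (unfold W in *; lra).
  assert (Z := RInt_eq_0_on p q psi hpq cpsi psi_ge0 E').
  apply (constant_on p q (fun x => h x / u x)); auto using cont_on_div.
  intros t ht. specialize (Z t ht).
  assert (k := hP t ltac:(lra)). assert (k0 := hu0 t ltac:(lra)).
  specialize (hu t ht). specialize (hh t ht).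
  assert (h' t - v t * h t / (P t * u t) = 0).
  { unfold psi in Z. apply Rmult_integral in Z as [Z|Z]; [lra|].
    simpl in Z. rewrite Rmult_1_r in Z. apply Rsqr_0_uniq; auto. }
  auto_derive.
  + repeat split; auto; eexists; eauto.
  + change (Derive (fun t => u t) t) with (Derive u t).
    change (Derive (fun t => h t) t) with (Derive h t).
    rewrite (is_derive_unique _ _ _ hu), (is_derive_unique _ _ _ hh).
    replace (h' t) with (v t * h t / (P t * u t)) by lra.
    field. lra.
Qed.

Lemma is_derive_on_of_C_on (n : nat) (a b : R) (f : R -> R) (x : R) :
  a < b -> a <= x <= b -> C_on (S n) a b f ->
  is_derive_on a b f x (derive_on a b f x).
Proof. intros hab hx [_ [H _]]. apply is_derive_on_derive_on; auto. Qed.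

Lemma cont_on_of_C_on (n : nat) (a b : R) (f : R -> R) :
  C_on n a b f -> cont_on a b f.
Proof. destruct n; intros [H _]; exact H. Qed.

(** An explicit derivative may replace [derive_on], since derivatives relative to a nondegenerate
    interval are unique. *)
Lemma C_on_1_intro (a b : R) (f f' : R -> R) :
  a < b -> cont_on a b f' ->
  (forall x, a <= x <= b -> is_derive_on a b f x (f' x)) -> C_on 1 a b f.
Proof.
intros hab hf' H. split; [|split; [|split; [|trivial]]].
- intros x hx. apply is_derive_on_continue with (f' x); auto.
- intros x hx. exists (f' x); auto.
- apply (cont_on_sub a b a b f'); auto; try lra.
  intros x hx. apply derive_on_unique; auto.
Qed.

Lemma steps_mono (t : nat -> R) (n : nat) :
  (forall i, (i < n)%nat -> t i < t (S i)) ->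
  forall i j, (i <= j <= n)%nat -> t i <= t j.
Proof.
intros H i j [hij hjn]. induction hij; [lra|].
specialize (H m ltac:(lia)). specialize (IHhij ltac:(lia)). lra.
Qed.

(** Induction over the pieces: the boundary terms telescope because [v h^2 / u] takes a single value
    at each breakpoint, and the constants [h / u] of adjacent pieces agree there. *)
Lemma Riccati_pieces (a b : R) (P Q L u v h : R -> R) (n : nat) (t : nat -> R) :
  a < b -> cont_on a b P -> cont_on a b L -> cont_on a b u -> cont_on a b v ->
  cont_on a b h ->
  (forall x, a < x < b -> Q x = L x) ->
  (forall x, a <= x <= b -> 0 < P x) ->
  (forall x, a <= x <= b -> u x <> 0) ->
  (forall x, a < x < b -> is_derive u x (v x / P x)) ->
  (forall x, a < x < b -> is_derive v x (L x * u x)) ->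
  t O = a -> t n = b ->
  (forall i, (i < n)%nat -> t i < t (S i) /\ C_on 1 (t i) (t (S i)) h) ->
  forall m, (m <= n)%nat ->
  exists V : R, is_RInt (fun x => P x * derive_on a b h x ^ 2 + Q x * h x ^ 2) a (t m) V /\
    v (t m) / u (t m) * h (t m) ^ 2 - v a / u a * h a ^ 2 <= V /\
    (V = v (t m) / u (t m) * h (t m) ^ 2 - v a / u a * h a ^ 2 ->
     forall x, a <= x <= t m -> h x / u x = h a / u a).
Proof.
intros hab cP cL cu cv ch hQ hP hu0 hu hv t0 tn Ht m.
induction m as [|m IH]; intros hm.
- rewrite t0. exists 0. split; [apply (@is_RInt_point R_NormedModule)|]. split; [lra|].
  intros _ x hx. replace x with a by lra. auto.
- destruct (IH ltac:(lia)) as [V [I1 [I2 I3]]].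
  destruct (Ht m hm) as [hlt hC].
  assert (mono := steps_mono t n (fun i hi => proj1 (Ht i hi))).
  assert (ha := mono 0%nat m ltac:(lia)). assert (hb := mono (S m) n ltac:(lia)).
  rewrite t0 in ha. rewrite tn in hb.
  set (p := t m) in *. set (q := t (S m)) in *.
  assert (sub : forall f, cont_on a b f -> cont_on p q f).
  { intros f. apply cont_on_sub; auto. }
  assert (hd : forall x, p < x < q -> is_derive h x (derive_on p q h x)).
  { intros x hx. apply (is_derive_on_interior p q); auto.
    apply (is_derive_on_of_C_on 0); auto; lra. }
  destruct (Riccati_piece p q P L u v h (derive_on p q h)) as [V' [J1 [J2 J3]]]; auto;
    try (intros x hx; (apply hP || apply hu0 || apply hu || apply hv); lra).
  { apply cont_on_of_C_on with 0%nat, hC. }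
  exists (V + V'). split; [|split].
  + apply (@is_RInt_Chasles R_NormedModule _ a p q V V'); auto.
    (* Inside a piece, derivatives relative to the piece and to [[a, b]] coincide; the breakpoints
       do not affect the integral. *)
    eapply is_RInt_ext; [|exact J1].
    rewrite Rmin_left, Rmax_right by lra. intros x hx.
    rewrite hQ by lra.
    rewrite (derive_on_unique a b h x (derive_on p q h x)); auto; try lra.
    apply is_derive_on_interior; auto; lra.
  + lra.
  + intros E x hx.
    (* Both lower bounds must be attained, as their sum is. *)
    assert (K := I3 ltac:(lra)).
    destruct (Rle_dec x p) as [hxp|hxp]; [apply K; lra|].
    rewrite (J3 ltac:(lra) x ltac:(lra)). apply K; lra.
Qed.

(** * The solution truncated at a zero *)

Lemma Rmin_lipschitz (c x t : R) : Rabs (Rmin t c - Rmin x c) <= Rabs (t - x).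
Proof.
unfold Rmin; repeat destruct Rle_dec; unfold Rabs; repeat destruct Rcase_abs; lra.
Qed.

(* When [u c = 0], [u (Rmin x c)] is [u] on [a, c] extended by [0] to [c, b]. *)
Lemma piecewise_smooth_Rmin (a b c : R) (u u' : R -> R) :
  a < c <= b -> cont_on a b u' ->
  (forall x, a <= x <= b -> is_derive_on a b u x (u' x)) ->
  piecewise_smooth a b (fun x => u (Rmin x c)).
Proof.
intros hc cu' hu.
assert (left : C_on 1 a c (fun x => u (Rmin x c))).
{ apply C_on_1_intro with u'; [lra| |].
  - apply (cont_on_sub a b a c u'); auto; lra.
  - intros x hx. apply (is_derive_on_sub a b a c u); auto; try lra.
    + intros s hs. rewrite Rmin_left; auto; lra.
    + apply hu; lra. }
split.
- split; auto. intros x hx. apply continue_in_eps. intros e he.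
  assert (k := is_derive_on_continue _ _ _ _ _ (hu (Rmin x c)
    ltac:(unfold Rmin; destruct (Rle_dec x c); lra))).
  destruct (proj1 (continue_in_eps _ _ _) k e he) as [d [hd Hd]].
  exists d; split; auto. intros s hs hsx. apply Hd.
  + unfold segment in *. unfold Rmin. destruct (Rle_dec s c); lra.
  + eapply Rle_lt_trans; [apply Rmin_lipschitz|auto].
(* Pieces must have positive length, so [c = b] leaves a single one. *)
- destruct (Req_dec c b) as [->|n].
  + exists 1%nat, (fun i => match i with O => a | _ => b end).
    split; [|split]; auto. intros [|i] hi; [split; [lra|apply left]|lia].
  + exists 2%nat, (fun i => match i with O => a | 1%nat => c | _ => b end).
    split; [|split]; auto. intros [|[|i]] hi; [split; [lra|apply left]| |lia].
    split; [lra|]. apply C_on_1_intro with (fun _ => 0); [lra|apply cont_on_const|].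
    intros x hx.
    (* Enlarging the interval by [1] on each side makes every point of [[c, b]] interior, so the
       ordinary derivative of a constant applies. *)
    apply (is_derive_on_sub (c - 1) (b + 1) c b (fun _ => u c)); try lra.
    * intros s hs. rewrite Rmin_right; auto; lra.
    * apply is_derive_on_interior; [lra|]. apply @is_derive_const.
Qed.

(** On [[a, c]] the integrand is [v^2 / P + L u^2 = (u v)'], and [u v] vanishes at both ends; beyond
    [c] the integrand is [0]. *)
Lemma RInt_Rmin_eq_0 (a b c : R) (P Q L u v : R -> R) :
  a < c <= b -> cont_on a b P -> cont_on a b L -> cont_on a b u -> cont_on a b v ->
  (forall x, a < x < b -> Q x = L x) ->
  (forall x, a <= x <= b -> 0 < P x) ->
  (forall x, a < x < b -> is_derive u x (v x / P x)) ->
  (forall x, a < x < b -> is_derive v x (L x * u x)) ->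
  v a = 0 -> u c = 0 ->
  RInt (fun x => P x * derive_on a b (fun s => u (Rmin s c)) x ^ 2
                 + Q x * u (Rmin x c) ^ 2) a b = 0.
Proof.
intros hc cP cL cu cv hQ hP hu hv va uc.
apply is_RInt_unique.
replace 0 with (plus (u c * v c - u a * v a) (RInt (fun _ => 0) c b)).
2:{ rewrite RInt_const, va, uc. unfold plus, scal; simpl. unfold mult; simpl. ring. }
apply (@is_RInt_Chasles R_NormedModule) with c.
- apply is_RInt_ext with (fun x => v x * v x / P x + L x * u x ^ 2).
  + rewrite Rmin_left, Rmax_right by lra. intros x hx.
    rewrite Rmin_left by lra. rewrite hQ by lra.
    rewrite (derive_on_unique a b _ x (v x / P x)); try lra.
    * specialize (hP x ltac:(lra)). simpl. field. lra.
    * apply is_derive_on_interior; [lra|].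
      apply is_derive_ext_loc with u; [|apply hu; lra].
      apply (locally_interval _ x a c); try (simpl; lra).
      intros s h1 h2; simpl in *. rewrite Rmin_left; auto; lra.
  + assert (sub : forall f, cont_on a b f -> cont_on a c f).
    { intros f. apply cont_on_sub; auto; lra. }
    apply (FTC_on a c (fun x => u x * v x)); [lra|auto using cont_on_mult| |].
    * apply cont_on_plus.
      -- apply cont_on_div; auto using cont_on_mult.
         intros x hx. specialize (hP x ltac:(lra)). lra.
      -- apply cont_on_mult; auto using cont_on_sqr.
    * intros x hx. specialize (hu x ltac:(lra)). specialize (hv x ltac:(lra)).
      specialize (hP x ltac:(lra)).
      auto_derive.
      -- repeat split; eexists; eauto.
      -- change (Derive (fun t => u t) x) with (Derive u x).
         change (Derive (fun t => v t) x) with (Derive v x).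
         rewrite (is_derive_unique _ _ _ hu), (is_derive_unique _ _ _ hv).
         field. lra.
- apply is_RInt_ext with (fun _ => 0).
  + rewrite Rmin_left, Rmax_right by lra. intros x hx.
    rewrite Rmin_right by lra. rewrite uc.
    rewrite (derive_on_unique a b _ x 0); try lra.
    apply is_derive_on_interior; [lra|].
    apply is_derive_ext_loc with (fun _ => 0); [|apply @is_derive_const].
    apply (locally_interval _ x c p_infty); try (simpl; auto; lra).
    intros s h1 h2; simpl in *. rewrite Rmin_right; auto; lra.
  + apply (@RInt_correct R_CompleteNormedModule), ex_RInt_const.
Qed.

(** * Continuity of the coefficient [Q] *)

(** [F] of class three makes [dy (dz F)] of class one, and [y] of class two makes [y'] of class one,
    so the chain rule expands [dR/dx] into terms continuous up to the ends; [L] is built from that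
    expansion. *)
Lemma coefQ_interior (a b : R) (D : R * R * R -> Prop) (F : R -> R -> R -> R)
    (y : R -> R) :
  a < b -> open D -> C3v 3 D F -> C_on 2 a b y ->
  (forall x, a <= x <= b -> D (x, y x, derive_on a b y x)) ->
  exists L, cont_on a b L /\ forall x, a < x < b -> coefQ a b F y x = L x.
Proof.
intros hab hD hF hy hyD.
set (z := derive_on a b y).
assert (hz : C_on 1 a b z) by apply hy.
set (G := dy (dz F)).
assert (hG : C3v 1 D G) by apply hF.
assert (hFyy : C3v 1 D (dy (dy F))) by apply hF.
assert (cy : cont_on a b y) by (apply cont_on_of_C_on with 2%nat; auto).
assert (cz : cont_on a b z) by (apply cont_on_of_C_on with 1%nat; auto).
assert (cz' : cont_on a b (derive_on a b z)).
{ apply cont_on_of_C_on with 0%nat, hz. }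
assert (along_cont : forall H, C3v 0 D H -> cont_on a b (along a b y H)).
{ intros H hH. apply (cont_on_comp3 a b D H y z); auto. }
exists (fun x => along a b y (dy (dy F)) x -
  (along a b y (dx G) x + along a b y (dy G) x * z x
   + along a b y (dz G) x * derive_on a b z x)).
split.
- apply cont_on_minus; [apply along_cont, C3v_0 with 1%nat; auto|].
  repeat apply cont_on_plus; repeat apply cont_on_mult; auto;
  apply along_cont, hG.
- intros x hx. unfold coefQ. f_equal.
  apply derive_on_unique; try lra.
  apply is_derive_on_interior; auto.
  apply (is_derive_comp3 D G y z); auto.
  + apply hyD; lra.
  + apply (is_derive_on_interior a b); auto.
    apply (is_derive_on_of_C_on 1); auto; lra.
  + apply (is_derive_on_interior a b); auto.
    apply (is_derive_on_of_C_on 0); auto; lra.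
Qed.

(** * The equivalence, from the first-order system for [u] and [v] *)

Theorem theorem3 (a b B : R) (D : R * R * R -> Prop) (F : R -> R -> R -> R)
    (y u : R -> R)
    (hab : a < b)
    (hD : open D)
    (hF : C3v 3 D F)
    (hy : C_on 2 a b y)
    (hyD : forall x, a <= x <= b -> D (x, y x, derive_on a b y x))
    (hext : extremal a b F y)
    (hya : is_derive_on a b y a 0)
    (hyb : y b = B)
    (hP : forall x, a <= x <= b -> 0 < coefP a b F y x)
    (hR : coefR a b F y a = 0)
    (hu : jacobi_solution a b (coefP a b F y) (coefQ a b F y) u)
    (hu0 : nonzero_on a b u)
    (hua : is_derive_on a b u a 0) :
  (forall h : R -> R,
      piecewise_smooth a b h -> nonzero_on a b h ->
      is_derive_on a b h a 0 -> h b = 0 ->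
      0 < second_variation a b (coefP a b F y) (coefQ a b F y) (coefR a b F y) h)
  <-> (forall x, a < x <= b -> u x <> 0).
Proof.
destruct (coefQ_interior a b D F y) as [L [cL hQ]]; auto.
assert (cP : cont_on a b (coefP a b F y)).
{ apply (cont_on_comp3 a b D); auto.
  - apply C3v_0 with 1%nat. apply hF.
  - apply cont_on_of_C_on with 2%nat; auto.
  - apply cont_on_of_C_on with 1%nat, hy. }
set (P := coefP a b F y) in *.
set (Q := coefQ a b F y) in *.
set (v := fun s => P s * derive_on a b u s).
assert (du : forall x, a <= x <= b -> is_derive_on a b u x (v x / P x)).
{ intros x hx. assert (k := hP x hx).
  replace (v x / P x) with (derive_on a b u x) by (unfold v; field; lra).
  apply is_derive_on_derive_on; auto. apply hu; auto. }
assert (dv : forall x, a <= x <= b -> is_derive_on a b v x (Q x * u x)).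
{ intros x hx. destruct (hu x hx) as [_ [h1 h2]]. unfold jacobi_op in h2.
  replace (Q x * u x) with (derive_on a b v x) by (unfold v; lra).
  apply is_derive_on_derive_on; auto. }
assert (cu : cont_on a b u).
{ intros x hx. apply is_derive_on_continue with (v x / P x); auto. }
assert (cv : cont_on a b v).
{ intros x hx. apply is_derive_on_continue with (Q x * u x); auto. }
assert (iu : forall x, a < x < b -> is_derive u x (v x / P x)).
{ intros x hx. apply (is_derive_on_interior a b); auto. apply du; lra. }
assert (iv : forall x, a < x < b -> is_derive v x (L x * u x)).
{ intros x hx. apply (is_derive_on_interior a b); auto.
  rewrite <- hQ by auto. apply dv; lra. }
assert (va : v a = 0).
{ unfold v. rewrite (derive_on_unique a b u a 0); auto; lra. }
(* Zero initial data for both [u] and [v] would make [u] vanish identically. *)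
assert (ua : u a <> 0).
{ intros ua. destruct hu0 as [x [hx hux]]. apply hux.
  apply (linear_system_unique a b P L u v); auto. }
split.
- intros H c hc uc.
  set (h := fun x => u (Rmin x c)).
  assert (ha : h a = u a) by (unfold h; rewrite Rmin_left; auto; lra).
  assert (hb : h b = 0) by (unfold h; rewrite Rmin_right; auto; lra).
  assert (K : 0 < second_variation a b P Q (coefR a b F y) h).
  { apply H; auto.
    - apply (piecewise_smooth_Rmin a b c u (fun x => v x / P x)); auto.
      apply cont_on_div; auto. intros x hx. specialize (hP x hx). lra.
    - exists a. rewrite ha. split; [lra|auto].
    (* Within distance [c - a] of [a] the truncated function is [u], so it inherits the free
       condition at [a]. *)
    - intros e he. destruct (hua e he) as [d [hd Hd]].
      exists (Rmin d (c - a)). split; [apply Rmin_glb_lt; lra|].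
      intros x [hx hxd]. assert (m1 := Rmin_l d (c - a)).
      assert (m2 := Rmin_r d (c - a)).
      assert (hxc : x - a < c - a).
      { eapply Rle_lt_trans; [apply Rle_abs|]. simpl in hxd. unfold Rdist in hxd. lra. }
      rewrite ha. replace (h x) with (u x) by (unfold h; rewrite Rmin_left; auto; lra).
      apply Hd. split; auto. lra. }
  unfold second_variation in K.
  (* Only the occurrences under the integral are unfolded; the boundary term at [b] dies by
     [h b = 0], the one at [a] by [R a = 0]. *)
  unfold h in K at 3 4. rewrite hb, hR in K.
  rewrite (RInt_Rmin_eq_0 a b c P Q L u v) in K; auto. lra.
- intros hu1 h [hc0 [n [t [t0 [tn Ht]]]]] [x0 [hx0 hhx0]] _ hb.
  assert (un0 : forall x, a <= x <= b -> u x <> 0).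
  { intros x hx. destruct (Req_dec x a) as [->|k]; auto. apply hu1; lra. }
  destruct (Riccati_pieces a b P Q L u v h n t) with n as [V [I1 [I2 I3]]]; auto.
  { apply cont_on_of_C_on with 0%nat; auto. }
  rewrite tn in *. rewrite hb, va in *.
  unfold second_variation. rewrite hb, hR, (is_RInt_unique _ _ _ _ I1).
  (* The lower bound is [0]: [h] vanishes at [b] and [v] at [a]. *)
  assert (E : v b / u b * 0 ^ 2 - 0 / u a * h a ^ 2 = 0).
  { field. split; apply un0; lra. }
  rewrite E in *.
  destruct (Rle_lt_or_eq_dec 0 V I2) as [k|k]; [lra|].
  exfalso. apply hhx0.
  (* Equality makes [h / u] constant, and its value at [b] is [0], so [h x0 = 0]. *)
  assert (E1 := I3 (eq_sym k)).
  assert (E2 := E1 b ltac:(lra)). rewrite <- (E1 x0 hx0), hb in E2.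
  assert (k1 := un0 x0 hx0).
  replace (h x0) with (h x0 / u x0 * u x0) by (field; auto).
  rewrite <- E2. unfold Rdiv. ring.
Qed.
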